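(* Let $G$ be a Lie group and let $V$ be a metrizable bornological vector space. Then every differentiable representation $\pi\colon G\to\mathrm{Aut}(V)$ is smooth.
   Context: Bornological vector spaces are over $\mathbb{C}$ and always complete and convex: every bounded set is contained in a bounded complete disk, that is, a bounded disk $T$ whose linear span $V_T$, normed so that $T$ is the closed unit ball, is a Banach space. A bornological vector space is metrizable if for any sequence $(S_n)$ of bounded subsets there is a sequence of (nonzero) scalars $(\epsilon_n)$ such that $\sum\epsilon_nS_n$ is bounded. $\mathrm{Aut}(V)$ is the group of invertible elements of the algebra of bounded linear operators on $V$. A representation of $G$ on $V$ is a group homomorphism $\pi\colon G\to\mathrm{Aut}(V)$; put $\pi_\ast(v)(g)=\pi_g(v)$. For a Banach space $B$, $\mathcal{D}(G,B)$ is the space of compactly supported smooth functions $G\to B$; a subset $S$ is bounded if its elements are supported in a common compact set and $D(S)$ is uniformly bounded for every differential operator $D$ on $G$. For $k\in\mathbb{N}$, $\mathcal{C}^k_c(G,B)$ is the usual LF-space of $k$ times continuously differentiable compactly supported functions with the von Neumann bornology. For a bornological vector space $V$, put $\mathcal{D}(G,V)=\varinjlim_T\mathcal{D}(G,V_T)$ and $\mathcal{C}^k_c(G,V)=\varinjlim_T\mathcal{C}^k_c(G,V_T)$ over bounded complete disks $T\subseteq V$ (direct union bornologies), and $\mathcal{C}^\infty_c(G,V)=\varprojlim_k\mathcal{C}^k_c(G,V)$. $\mathcal{E}(G,V)$, respectively $\mathcal{C}^\infty(G,V)$, is the space of functions $f\colon G\to V$ with $h\cdot f\in\mathcal{D}(G,V)$,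 respectively $h\cdot f\in\mathcal{C}^\infty_c(G,V)$, for all compactly supported smooth $h\colon G\to\mathbb{C}$; a subset $S$ is bounded if $h\cdot S$ is bounded in the respective space for all such $h$. $\pi$ is smooth if $\pi_\ast$ is a bounded linear map $V\to\mathcal{E}(G,V)$, and differentiable if $\pi_\ast$ is a bounded linear map $V\to\mathcal{C}^\infty(G,V)$. *)

(* Defs.v *)
From HB Require Import structures.
From mathcomp Require Import all_boot all_order all_algebra.
From mathcomp Require Import complex.
From mathcomp Require Import all_classical all_reals all_analysis.

Set Implicit Arguments.
Unset Strict Implicit.
Unset Printing Implicit Defensive.

Import Order.TTheory GRing.Theory Num.Theory.
Import numFieldNormedType.Exports.

Local Open Scope classical_set_scope.
Local Open Scope ring_scope.
Local Open Scope complex_scope.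

Section Calculus.

(* Functions of p real variables with values in a normed space over K; the
   embedding iota of the reals into K is the identity (K = R) for transition
   maps and the canonical embedding (K = R[i]) for vector-valued functions. *)
Context {R : realType} {K : numFieldType} (iota : {rmorphism R -> K}).
Context {p : nat} {W : normedModType K}.
Implicit Types (f : 'rV[R]_p -> W) (O : set 'rV[R]_p) (t : seq 'I_p).

Definition diff_quotient (i : 'I_p) f (x : 'rV[R]_p) (h : R) : W :=
  iota h^-1 *: (f (x + h *: delta_mx 0 i) - f x).

Definition has_partial i f x : Prop := cvg (diff_quotient i f x h @[h --> 0^']).

Definition partial i f (x : 'rV[R]_p) : W :=
  lim (diff_quotient i f x h @[h --> 0^']).

(* partials [:: i1; ...; im] f = d_im ... d_i1 f *)
Definition partials t f := foldl (fun g i => partial i g) f t.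

(* meant for O open *)
Fixpoint Ck_on (k : nat) O f : Prop :=
  (forall x, O x -> {for x, continuous f}) /\
  if k is k'.+1 then
    forall i, (forall x, O x -> has_partial i f x) /\ Ck_on k' O (partial i f)
  else True.

Definition smooth_on O f : Prop := forall k, Ck_on k O f.

End Calculus.

Definition smooth_real {R : realType} {p q : nat}
    (O : set 'rV[R]_p) (f : 'rV[R]_p -> 'rV[R]_q) : Prop :=
  smooth_on (idfun : {rmorphism R -> R}) O f.

HB.mixin Record isTopologicalGroup G & Topological G & Group G := {
  mulg_continuous : continuous (fun xy : G * G => (xy.1 * xy.2)%g);
  invg_continuous : continuous (fun x : G => (x^-1)%g)
}.

#[short(type="topGroupType")]
HB.structure Definition TopGroup :=
  { G of Topological G & Group G & isTopologicalGroup G }.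

Record chart (R : realType) (n : nat) (G : topologicalType) := Chart {
  chart_dom : set G;
  chart_img : set 'rV[R]_n;
  chart_map : G -> 'rV[R]_n;
  chart_inv : 'rV[R]_n -> G;
  chart_dom_open : open chart_dom;
  chart_img_open : open chart_img;
  chart_map_img : forall g, chart_dom g -> chart_img (chart_map g);
  chart_inv_dom : forall x, chart_img x -> chart_dom (chart_inv x);
  chart_mapK : forall g, chart_dom g -> chart_inv (chart_map g) = g;
  chart_invK : forall x, chart_img x -> chart_map (chart_inv x) = x;
  chart_map_continuous :
    forall g, chart_dom g -> {for g, continuous chart_map};
  chart_inv_continuous :
    forall x, chart_img x -> {for x, continuous chart_inv}
}.

HB.mixin Record isLieGroup (R : realType) (n : nat) G & TopGroup G := {
  atlas : set (chart R n G);
  lie_hausdorff : hausdorff_space G;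
  atlas_cover : forall g : G, exists2 c, atlas c & chart_dom c g;
  atlas_compatible : forall c d, atlas c -> atlas d ->
    smooth_real
      [set x | chart_img c x /\ chart_dom d (chart_inv c x)]
      (fun x => chart_map d (chart_inv c x));
  mulg_smooth : forall c d e, atlas c -> atlas d -> atlas e ->
    smooth_real
      [set x : 'rV[R]_(n + n) |
        [/\ chart_img c (lsubmx x), chart_img d (rsubmx x) &
            chart_dom e (chart_inv c (lsubmx x) * chart_inv d (rsubmx x))%g]]
      (fun x => chart_map e
                  (chart_inv c (lsubmx x) * chart_inv d (rsubmx x))%g);
  invg_smooth : forall c d, atlas c -> atlas d ->
    smooth_real
      [set x | chart_img c x /\ chart_dom d (chart_inv c x)^-1%g]
      (fun x => chart_map d (chart_inv c x)^-1%g)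
}.

#[short(type="lieGroupType")]
HB.structure Definition LieGroup (R : realType) (n : nat) :=
  { G of TopGroup G & isLieGroup R n G }.

Section BanachValued.

Context {R : realType} {n : nat} (G : lieGroupType R n).
Context (B : normedModType R[i]).
Implicit Types (k : nat) (f : G -> B) (K : set G) (S U : set (G -> B)).
Implicit Types (D : (G -> B) -> G -> B).

Let toC : {rmorphism R -> R[i]} := real_complex R.

Definition Ck k f : Prop :=
  forall c, @atlas R n G c -> Ck_on toC k (chart_img c) (f \o chart_inv c).

Definition smooth f : Prop := forall k, Ck k f.

Definition supported_in K f : Prop := forall g, ~ K g -> f g = 0.

(* Differential operators with smooth complex coefficients, acting on B-valued
   functions, of order at most k.  The values of D outside the C^k functions
   are irrelevant.  The multi-indices t are words, so that the coefficients a
   are not unique. *)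
Definition diff_op k D : Prop :=
  forall c, @atlas R n G c ->
  exists a : seq 'I_n -> 'rV[R]_n -> R[i],
    (forall t, smooth_on (W := R[i]^o) toC (chart_img c) (a t)) /\
    forall f, Ck k f -> forall x, chart_img c x ->
      D f (chart_inv c x) =
      \sum_(j < k.+1) \sum_(t : j.-tuple 'I_n)
         a t x *: partials toC t (f \o chart_inv c) x.

Definition unif_bounded S : Prop :=
  exists M : R, forall f, S f -> forall g, `|f g| <= M%:C.

Definition test_fun f : Prop :=
  smooth f /\ exists2 K, compact K & supported_in K f.

Definition test_bounded S : Prop :=
  [/\ (forall f, S f -> smooth f),
      (exists2 K, compact K & forall f, S f -> supported_in K f) &
      forall k D, diff_op k D -> unif_bounded [set D f | f in S]].

Definition Ck_in k K : set (G -> B) := [set f | Ck k f /\ supported_in K f].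

Definition Ckc k : set (G -> B) := [set f | exists2 K, compact K & Ck_in k K f].

(* Topology of uniform convergence of all derivatives of order at most k. *)
Definition Ck_in_nbhs0 k K U : Prop :=
  exists (m : nat) (D : 'I_m -> (G -> B) -> G -> B) (e : R),
    [/\ forall j, diff_op k (D j), 0 < e &
        forall f, Ck_in k K f ->
          (forall j g, `|D j f g| <= e%:C) -> U f].

Definition abs_convex U : Prop :=
  forall f1 f2 (a b : R[i]), U f1 -> U f2 -> `|a| + `|b| <= 1 ->
    U (fun g => a *: f1 g + b *: f2 g).

(* Basic 0-neighbourhoods of the locally convex inductive limit over the
   compact subsets K of G. *)
Definition LF_nbhs0 k U : Prop :=
  [/\ U `<=` Ckc k, abs_convex U &
      forall K, compact K -> Ck_in_nbhs0 k K (U `&` Ck_in k K)].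

(* von Neumann bornology *)
Definition Ckc_bounded k S : Prop :=
  S `<=` Ckc k /\
  forall U, LF_nbhs0 k U ->
    exists2 r : R, 0 < r &
      S `<=` [set (fun g => r%:C *: f g) | f in U].

End BanachValued.

(* The normed space V_T of a complete disk T, up to (unique) isometry: a Banach
   space with an injective linear map to V carrying its closed unit ball onto T;
   its image is then the linear span of T and its norm is the gauge of T. *)
Record banach_disk (R : realType) (V : lmodType R[i]) (T : set V) :=
  BanachDisk {
  disk_space :> completeNormedModType R[i];
  disk_incl : {linear disk_space -> V};
  disk_incl_inj : injective disk_incl;
  disk_ball : disk_incl @` [set x | `|x| <= 1] = T
}.

HB.mixin Record isCompleteBornological (R : realType) V
    & GRing.Lmodule R[i] V := {
  bdd : set (set V);
  bdd_set1 : forall x : V, bdd [set x];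
  bdd_sub : forall A B : set V, A `<=` B -> bdd B -> bdd A;
  bdd_setU : forall A B : set V, bdd A -> bdd B -> bdd (A `|` B);
  bdd_add : forall A B : set V,
    bdd A -> bdd B -> bdd [set x + y | x in A & y in B];
  bdd_scale : forall (r : R) (A : set V),
    bdd A -> bdd [set c *: x | c in [set c : R[i] | `|c| <= r%:C] & x in A];
  bdd_complete : forall A : set V, bdd A ->
    exists2 T, A `<=` T & bdd T /\ inhabited (banach_disk T)
}.

#[short(type="bornVectType")]
HB.structure Definition BornVect (R : realType) :=
  { V of GRing.Lmodule R[i] V & isCompleteBornological R V }.

Section Bornological.

Context {R : realType} (V : bornVectType R).

Definition born_series_to (v : nat -> V) (x : V) : Prop :=
  exists (T : set V) (d : banach_disk T) (w : nat -> d) (l : d),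
    [/\ bdd T, (forall m, disk_incl d (w m) = v m),
        series w @ \oo --> l & disk_incl d l = x].

(* The sum of the sets eps_m S_m: all series are required to converge, so that
   the set of their sums cannot be made bounded by divergence. *)
Definition metrizable : Prop :=
  forall S : nat -> set V, (forall m, bdd (S m)) ->
  exists eps : nat -> R[i],
    [/\ (forall m, eps m != 0),
        (forall s : nat -> V, (forall m, S m (s m)) ->
           exists x, born_series_to (fun m => eps m *: s m) x) &
        bdd [set x | exists2 s : nat -> V, (forall m, S m (s m)) &
                       born_series_to (fun m => eps m *: s m) x]].

Definition bounded_operator (f : V -> V) : Prop :=
  linear f /\ forall A : set V, bdd A -> bdd (f @` A).

Definition automorphism (f : V -> V) : Prop :=
  bounded_operator f /\
  exists f', [/\ bounded_operator f', cancel f f' & cancel f' f].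

Context {n : nat} (G : lieGroupType R n).
Implicit Types (S : set (G -> V)) (f : G -> V) (h : G -> R[i]^o).

(* For a bornology indexed by Banach spaces B (on functions G -> B), the direct
   union over the bounded complete disks of V. *)
Definition union_bounded
    (bnd : forall B : normedModType R[i], set (set (G -> B))) S : Prop :=
  exists (T : set V) (d : banach_disk T) (S' : set (G -> d)),
    [/\ bdd T, bnd d S' & S = [set disk_incl d \o f | f in S']].

Definition D_bounded S : Prop :=
  union_bounded (fun B => @test_bounded R n G B) S.

Definition in_D f : Prop :=
  exists (T : set V) (d : banach_disk T) (f' : G -> d),
    [/\ bdd T, test_fun f' & f = disk_incl d \o f'].

Definition CkcV_bounded k S : Prop :=
  union_bounded (fun B => @Ckc_bounded R n G B k) S.

Definition in_CkcV k f : Prop :=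
  exists (T : set V) (d : banach_disk T) (f' : G -> d),
    [/\ bdd T, Ckc k f' & f = disk_incl d \o f'].

Definition Cinfc_bounded S : Prop := forall k, CkcV_bounded k S.

Definition in_Cinfc f : Prop := forall k, in_CkcV k f.

Definition mul_fun h f : G -> V := fun g => h g *: f g.

Definition in_E f : Prop := forall h, test_fun h -> in_D (mul_fun h f).

Definition E_bounded S : Prop :=
  S `<=` in_E /\ forall h, test_fun h -> D_bounded [set mul_fun h f | f in S].

Definition in_Cinf f : Prop := forall h, test_fun h -> in_Cinfc (mul_fun h f).

Definition Cinf_bounded S : Prop :=
  S `<=` in_Cinf /\
  forall h, test_fun h -> Cinfc_bounded [set mul_fun h f | f in S].

Implicit Type pi : G -> V -> V.

Definition representation pi : Prop :=
  (forall g, automorphism (pi g)) /\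
  forall x y v, pi (x * y)%g v = pi x (pi y v).

Definition orbit_map pi (v : V) : G -> V := fun g => pi g v.

Definition bounded_linear_to (E : set (G -> V)) (bnd : set (set (G -> V)))
    (F : V -> G -> V) : Prop :=
  [/\ (forall (a : R[i]) u v g, F (a *: u + v) g = a *: F u g + F v g),
      (forall v, E (F v)) &
      forall A : set V, bdd A -> bnd (F @` A)].

Definition smooth_rep pi : Prop :=
  bounded_linear_to in_E E_bounded (orbit_map pi).

Definition differentiable_rep pi : Prop :=
  bounded_linear_to in_Cinf Cinf_bounded (orbit_map pi).

End Bornological.

(* Main.v *)
(* Over a metrizable V, Cinf_c(G,V) and D(G,V) agree: if a family with common
   compact support is bounded in C^k_c(G,V_{T_k}) for every k, metrizability
   gives nonzero scalars eps_k and one bounded complete disk T containing all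
   eps_k T_k, so the inclusions V_{T_k} -> V_T are bounded and carry every C^k
   bound over to the single Banach space V_T.  Multiplication by a test function
   h forces all supports into supp h, so the elementary half of the description
   of bounded subsets of an LF-space suffices. *)
Require Import Defs.
From HB Require Import structures.
From mathcomp Require Import all_boot all_order all_algebra.
From mathcomp Require Import complex.
From mathcomp Require Import all_classical all_reals all_analysis.

Set Implicit Arguments.
Unset Strict Implicit.
Unset Printing Implicit Defensive.

Import Order.TTheory GRing.Theory Num.Theory.
Import numFieldNormedType.Exports.

Local Open Scope classical_set_scope.
Local Open Scope ring_scope.
Local Open Scope complex_scope.

(** * Locality and linearity of partial derivatives on an open set *)

Section PartialsOn.

Context {R : realType} {K : numFieldType} (iota : {rmorphism R -> K}).
Context {p : nat} (O : set 'rV[R]_p).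
Context (oO : open O).

(** For small [h] the point [x + h *: delta_mx 0 i] stays in the open set [O]. Equality of the two
    filters, rather than of limits, transfers both the existence and the value of partial
    derivatives. *)
Lemma diff_quotient_fmap_eq {W : normedModType K} i (f g : 'rV[R]_p -> W) x :
  (forall y, O y -> f y = g y) -> O x ->
  diff_quotient iota i f x h @[h --> 0^'] =
  diff_quotient iota i g x h @[h --> 0^'].
Proof.
move=> fg Ox.
have nfg : \forall h \near 0^',
    diff_quotient iota i f x h = diff_quotient iota i g x h.
  have c : x + h *: delta_mx 0 i @[h --> (0 : R)^'] -->
      x + 0 *: delta_mx 0 i.
    apply: cvg_within_filter.
    by apply: cvgD; [exact: cvg_cst | apply: cvgZr_tmp; exact: cvg_id].
  rewrite scale0r addr0 in c.
  have nO : \forall h \near (0 : R)^', O (x + h *: delta_mx 0 i).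
    exact: c _ (open_nbhs_nbhs (conj oO Ox)).
  by apply: filterS nO => h Oh; rewrite /diff_quotient !fg.
apply/seteqP; split; apply: near_eq_cvg => //.
by apply: filterS nfg => h ->.
Qed.

Lemma has_partial_eq_on {W : normedModType K} i (f g : 'rV[R]_p -> W) x :
  (forall y, O y -> f y = g y) -> O x ->
  has_partial iota i f x -> has_partial iota i g x.
Proof.
by move=> fg Ox; rewrite /has_partial (diff_quotient_fmap_eq i fg Ox).
Qed.

Lemma partial_eq_on {W : normedModType K} i (f g : 'rV[R]_p -> W) x :
  (forall y, O y -> f y = g y) -> O x ->
  partial iota i f x = partial iota i g x.
Proof. by move=> fg Ox; rewrite /partial (diff_quotient_fmap_eq i fg Ox). Qed.

Lemma partials_eq_on {W : normedModType K} t (f g : 'rV[R]_p -> W) x :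
  (forall y, O y -> f y = g y) -> O x ->
  partials iota t f x = partials iota t g x.
Proof.
elim: t f g => [|i t IH] f g fg Ox /=; first exact: fg.
by apply: IH => // y Oy; exact: partial_eq_on.
Qed.

Lemma Ck_on_eq {W : normedModType K} k (f g : 'rV[R]_p -> W) :
  (forall y, O y -> f y = g y) -> Ck_on iota k O f -> Ck_on iota k O g.
Proof.
elim: k f g => [|k IH] f g fg [cf df];
  (have cg x : O x -> {for x, continuous g} by
    move=> Ox; rewrite /prop_for /continuous_at -fg //;
    apply: cvg_trans (cf x Ox); apply: (@near_eq_cvg _ _ (nbhs x) _ f g);
    apply: filterS (open_nbhs_nbhs (conj oO Ox)) => y; exact: fg); split=> //.
move=> i; have [pf Cf] := df i; split.
  by move=> x Ox; apply: has_partial_eq_on fg Ox (pf x Ox).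
by apply: IH Cf => y Oy; exact: partial_eq_on.
Qed.

Section LinearCombination.

Context {B1 B2 W : normedModType K}.
Context (L1 : {linear B1 -> W}) (L2 : {linear B2 -> W}).
Context (cL1 : continuous L1) (cL2 : continuous L2).

(** Two linear maps on possibly different spaces are treated at once: scalings [L1], [L2] give
    linear combinations of functions, and [L2] zero gives composition with a single map. *)
Lemma cvg_partial_lin i (f1 : 'rV[R]_p -> B1) (f2 : 'rV[R]_p -> B2) x :
  has_partial iota i f1 x -> has_partial iota i f2 x ->
  diff_quotient iota i (fun y => L1 (f1 y) + L2 (f2 y)) x h @[h --> 0^'] -->
  L1 (partial iota i f1 x) + L2 (partial iota i f2 x).
Proof.
move=> p1 p2.
have -> : diff_quotient iota i (fun y => L1 (f1 y) + L2 (f2 y)) x =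
    (fun h => L1 (diff_quotient iota i f1 x h) +
              L2 (diff_quotient iota i f2 x h)).
  apply/funext => h; rewrite /diff_quotient !linearZ /=.
  rewrite (linearB L1) (linearB L2) -scalerDr.
  by rewrite opprD addrACA.
by apply: cvgD; [apply: continuous_cvg p1; exact: cL1
                |apply: continuous_cvg p2; exact: cL2].
Qed.

Lemma partial_lin i (f1 : 'rV[R]_p -> B1) (f2 : 'rV[R]_p -> B2) x :
  has_partial iota i f1 x -> has_partial iota i f2 x ->
  partial iota i (fun y => L1 (f1 y) + L2 (f2 y)) x =
  L1 (partial iota i f1 x) + L2 (partial iota i f2 x).
Proof. by move=> p1 p2; apply: cvg_lim (cvg_partial_lin p1 p2). Qed.

Lemma Ck_on_lin k (f1 : 'rV[R]_p -> B1) (f2 : 'rV[R]_p -> B2) :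
  Ck_on iota k O f1 -> Ck_on iota k O f2 ->
  Ck_on iota k O (fun y => L1 (f1 y) + L2 (f2 y)).
Proof.
elim: k f1 f2 => [|k IH] f1 f2 [c1 d1] [c2 d2];
  (have cf x : O x -> {for x, continuous (fun y => L1 (f1 y) + L2 (f2 y))} by
    move=> Ox; apply: (@cvgD _ _ _ (nbhs x) _ (L1 \o f1) (L2 \o f2));
    [apply: continuous_comp (c1 x Ox) _; exact: cL1
    |apply: continuous_comp (c2 x Ox) _; exact: cL2]); split=> // i.
have [p1 C1] := d1 i; have [p2 C2] := d2 i; split.
  move=> x Ox; apply/cvg_ex; eexists.
  exact: cvg_partial_lin (p1 x Ox) (p2 x Ox).
(* The formula for [partial] is known only on [O], so the induction hypothesis is transported along
   equality on [O]. *)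
apply: Ck_on_eq (IH _ _ C1 C2) => y Oy.
by rewrite partial_lin; [| exact: p1 | exact: p2].
Qed.

Lemma partials_lin k t (f1 : 'rV[R]_p -> B1) (f2 : 'rV[R]_p -> B2) x :
  (size t <= k)%N -> Ck_on iota k O f1 -> Ck_on iota k O f2 -> O x ->
  partials iota t (fun y => L1 (f1 y) + L2 (f2 y)) x =
  L1 (partials iota t f1 x) + L2 (partials iota t f2 x).
Proof.
elim: t k f1 f2 => [//|i t IH] [//|k] f1 f2 tk [c1 d1] [c2 d2] Ox.
have [p1 C1] := d1 i; have [p2 C2] := d2 i.
rewrite /= -(IH k) //; apply: partials_eq_on Ox => y Oy.
by rewrite partial_lin; [| exact: p1 | exact: p2].
Qed.

End LinearCombination.

End PartialsOn.

(** * Differential operators on G and continuous linear maps between the value spaces *)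

Section LinearMaps.

Context {R : realType} {n : nat} (G : lieGroupType R n).

Lemma Ck_lin (B1 B2 W : normedModType R[i]) (L1 : {linear B1 -> W})
    (L2 : {linear B2 -> W}) k (f1 : G -> B1) (f2 : G -> B2) :
  continuous L1 -> continuous L2 -> Ck k f1 -> Ck k f2 ->
  Ck k (fun g => L1 (f1 g) + L2 (f2 g)).
Proof.
move=> c1 c2 C1 C2 c ac.
exact: (Ck_on_lin (@chart_img_open _ _ _ c) c1 c2 (C1 c ac) (C2 c ac)).
Qed.

(** [D] is a bare function; its linearity on C^k functions is read off from the local expression in
    a chart around [g]. *)
Lemma diff_op_comb (B : normedModType R[i]) k (D : (G -> B) -> G -> B)
    (a b : R[i]) (f1 f2 : G -> B) g :
  diff_op k D -> Ck k f1 -> Ck k f2 ->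
  D (fun g => a *: f1 g + b *: f2 g) g = a *: D f1 g + b *: D f2 g.
Proof.
move=> dD C1 C2.
have cs (c : R[i]) : continuous ( *:%R c : B -> B) by exact: scaler_continuous.
have [c ac cg] := @atlas_cover R n G g.
have [u [_ Du]] := dD c ac.
rewrite -(chart_mapK cg); have xc := chart_map_img cg.
set x := chart_map c g in xc *.
rewrite !Du //; last exact: (Ck_lin (cs a) (cs b) C1 C2).
rewrite !scaler_sumr -big_split /=; apply: eq_bigr => j _.
rewrite !scaler_sumr -big_split /=; apply: eq_bigr => t _.
rewrite (partials_lin (@chart_img_open _ _ _ c) (cs a) (cs b) _
  (C1 c ac) (C2 c ac)) //.
  by rewrite scalerDr !scalerA ![_ * u _ _]mulrC.
by rewrite size_tuple -ltnS.
Qed.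

(** The [f] in [Ckc k] with [|D f| <= 1] everywhere form a neighbourhood of 0 in the inductive limit
    topology, so some multiple of it contains the von Neumann bounded set [S]. *)
Lemma unif_bounded_diff_op (B : normedModType R[i]) k
    (D : (G -> B) -> G -> B) (S : set (G -> B)) :
  Ckc_bounded k S -> diff_op k D -> unif_bounded [set D f | f in S].
Proof.
move=> [SC bS] dD.
have [|r r0 Sr] := bS [set f | Ckc k f /\ forall g, `|D f g| <= 1].
  split=> [f []//| f1 f2 a b [[K1 cK1 [C1 s1]] D1] [[K2 cK2 [C2 s2]] D2] ab |].
    split.
      exists (K1 `|` K2); first exact: compactU.
      split; first exact: (Ck_lin (@scaler_continuous _ B a)
                                  (@scaler_continuous _ B b) C1 C2).
      by move=> g /not_orP[g1 g2]; rewrite s1 // s2 // !scaler0 addr0.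
    move=> g; rewrite (diff_op_comb _ _ _ dD) //.
    apply: le_trans (ler_normD _ _) _; rewrite !normrZ.
    apply: le_trans ab; rewrite lerD //.
      by rewrite -[leRHS]mulr1 ler_wpM2l.
    by rewrite -[leRHS]mulr1 ler_wpM2l.
  (* On each compact [K] the single operator [D] with radius 1 defines the neighbourhood. *)
  move=> K cK; exists 1%N, (fun=> D), 1; split=> // f CK Df.
  split=> //; split; first by exists K.
  by move=> g; exact: Df ord0 g.
exists r => _ [f Sf <-] g; have [f0 [[K _ [C0 _]] D0] <-] := Sr f Sf.
(* Homogeneity of [D] is the case of second coefficient 0; it turns the bound 1 for [f0] into the
   bound [r] for [f]. *)
have := diff_op_comb r%:C 0 g dD C0 C0.
rewrite (_ : (fun g => _) = (fun g => r%:C *: f0 g)); last first.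
  by apply/funext => h; rewrite scale0r addr0.
move=> ->; rewrite scale0r addr0 normrZ ger0_norm; last by rewrite lecR ltW.
by rewrite -[leRHS]mulr1 ler_wpM2l // lecR ltW.
Qed.

Lemma Ck_comp (B1 W : normedModType R[i]) (j : {linear B1 -> W}) k
    (f : G -> B1) :
  continuous j -> Ck k f -> Ck k (j \o f).
Proof.
move=> cj Cf.
have c0 : continuous (\0 : B1 -> W) by move=> x; exact: cvg_cst.
have -> : j \o f = (fun g => j (f g) + (\0 : {linear B1 -> W}) (f g)).
  by apply/funext => g /=; rewrite addr0.
exact: Ck_lin.
Qed.

(* Injectivity of j makes the local expressions of D agree on overlaps of charts
   already for B1-valued functions. *)
Lemma diff_op_pullback (B1 W : normedModType R[i]) (j : {linear B1 -> W}) k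
    (D : (G -> W) -> G -> W) :
  continuous j -> injective j -> diff_op k D ->
  exists2 D' : (G -> B1) -> G -> B1, diff_op k D' &
    forall f, Ck k f -> forall g, D (j \o f) g = j (D' f g).
Proof.
move=> cj ij dD.
have c0 : continuous (\0 : B1 -> W) by move=> x; exact: cvg_cst.
(* The coefficients are scalars and [j] commutes with partial derivatives, so [j] commutes with the
   local expression for the same [a]. *)
have local c (a : seq 'I_n -> 'rV[R]_n -> R[i]) (f : G -> B1) x :
    @atlas R n G c -> Ck k f -> chart_img c x ->
    \sum_(m < k.+1) \sum_(t : m.-tuple 'I_n)
      a t x *: partials (real_complex R) t ((j \o f) \o chart_inv c) x =
    j (\sum_(m < k.+1) \sum_(t : m.-tuple 'I_n)
      a t x *: partials (real_complex R) t (f \o chart_inv c) x).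
  move=> ac Cf xc; rewrite linear_sum; apply: eq_bigr => m _.
  rewrite linear_sum; apply: eq_bigr => t _; rewrite linearZ /=; congr (_ *: _).
  have tk : (size t <= k)%N by rewrite size_tuple -ltnS.
  have := partials_lin (@chart_img_open _ _ _ c) cj c0 tk
    (Cf c ac) (Cf c ac) xc.
  rewrite addr0 => <-; congr partials.
  by apply/funext => y /=; rewrite addr0.
(* The preimage of [D (j \o f) g] under [j]. It exists for C^k functions by [local]; the default 0
   can occur only for other [f], on which [diff_op] imposes no condition. *)
pose D' (f : G -> B1) g := xget 0 [set y | j y = D (j \o f) g].
have jD' f : Ck k f -> forall g, D (j \o f) g = j (D' f g).
  move=> Cf g; apply/esym/(@xgetPex _ 0 [set y | j y = D (j \o f) g]).
  have [c ac cg] := @atlas_cover R n G g; have [a [_ Da]] := dD c ac.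
  rewrite -(chart_mapK cg).
  rewrite Da; [|exact: Ck_comp|exact: chart_map_img].
  by eexists; rewrite local //; exact: chart_map_img.
exists D' => // c ac; have [a [sa Da]] := dD c ac.
exists a; split=> // f Cf x xc; apply: ij.
by rewrite -jD' // Da ?local //; exact: Ck_comp.
Qed.

End LinearMaps.

(** * Bounded complete disks and inclusions between their Banach spaces *)

Section Disks.

Context {R : realType} (V : bornVectType R).

Lemma disk_incl_ball (T : set V) (d : banach_disk T) (x : d) :
  `|x| <= 1 -> T (disk_incl d x).
Proof.
move=> x1; have : (disk_incl d @` [set x | `|x| <= 1]) (disk_incl d x).
  by exists x.
by rewrite disk_ball.
Qed.

Lemma disk_incl_onto (T : set V) (d : banach_disk T) (v : V) :
  T v -> exists2 x : d, `|x| <= 1 & disk_incl d x = v.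
Proof.
move=> Tv; have [x x1 xv] : (disk_incl d @` [set x | `|x| <= 1]) v.
  by rewrite disk_ball.
by exists x.
Qed.

Lemma banach_disk0 (T : set V) (d : banach_disk T) : T 0.
Proof.
by rewrite -(linear0 (disk_incl d)); apply: disk_incl_ball; rewrite normr0.
Qed.

(* A sum with a single nonzero term shows that each eps_m T_m lies in the
   bounded set provided by metrizability. *)
Lemma metrizable_absorb (T : nat -> set V) (d : forall m, banach_disk (T m)) :
  metrizable V -> (forall m, bdd (T m)) ->
  exists eps : nat -> R[i], (forall m, eps m != 0) /\
    bdd (\bigcup_m [set eps m *: x | x in T m]).
Proof.
move=> mV bT; have [eps [eps0 _ bE]] := mV T bT; exists eps; split=> //.
apply: bdd_sub bE => _ [m _ [x Tx <-]].
exists (fun k => if k == m then x else 0).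
  by move=> k; case: eqP => [->//|_]; exact: banach_disk0.
have [y _ yx] := disk_incl_onto (d m) Tx.
exists (T m), (d m), (fun k => if k == m then eps m *: y else 0), (eps m *: y).
split=> //; last by rewrite linearZ /= yx.
  by move=> k; case: eqP => [->|_]; rewrite ?linearZ ?linear0 ?scaler0 /= ?yx.
(* [series w N] sums the indices below [N], so the partial sums are constant from [m.+1] on. *)
apply: cvg_near_cst; exists m.+1 => // N /= mN.
rewrite /series /= (bigD1_seq m) ?mem_index_iota ?iota_uniq //= eqxx.
by rewrite big1 ?addr0 // => k /negbTE ->.
Qed.

(** If [e] times the unit ball of [d1] lies in that of [d2], the inclusion of the spans has norm at
    most [|e^-1|]. It is built pointwise by normalizing [x], which is why [x = 0] is treated
    apart. *)
Lemma disk_embedding (T1 T2 : set V) (d1 : banach_disk T1) (d2 : banach_disk T2)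
    (e : R[i]) :
  e != 0 -> [set e *: x | x in T1] `<=` T2 ->
  exists j : {linear d1 -> d2},
    [/\ forall x, disk_incl d2 (j x) = disk_incl d1 x,
        continuous j, injective j &
        exists2 C : R, 0 <= C & forall x, `|j x| <= C%:C * `|x|].
Proof.
move=> e0 eT.
have ex (x : d1) : exists y : d2,
    disk_incl d2 y = disk_incl d1 x /\ `|y| <= `|e^-1| * `|x|.
  have [->|x0] := eqVneq x 0.
    by exists 0; rewrite !linear0 !normr0 mulr0.
  have nx0 : `|x| != 0 by rewrite normr_eq0.
  have : T2 (e *: disk_incl d1 (`|x|^-1 *: x)).
    apply: eT; exists (disk_incl d1 (`|x|^-1 *: x)) => //.
    apply: disk_incl_ball.
    by rewrite normrZ normfV normr_id mulVf.
  move=> /(disk_incl_onto d2)[z z1 zx].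
  exists ((e^-1 * `|x|) *: z); split.
    rewrite linearZ /= zx linearZ /= scalerA mulVKf // linearZ /= scalerA.
    by rewrite mulfV // scale1r.
  by rewrite normrZ normrM normr_id -[leRHS]mulr1 ler_wpM2l.
have [j jP] := choice ex.
(* The pointwise choices are forced by injectivity of [disk_incl d2], hence they are linear. *)
have jlin : linear j.
  move=> a x y; apply: (@disk_incl_inj _ _ _ d2).
  by rewrite linearP !(jP _).1 linearP.
pose J : {linear d1 -> d2} := HB.pack j (GRing.isLinear.Build _ _ _ _ j jlin).
(* Norms take values in [R[i]]; the real constant is recovered as the real part. *)
have [C C0 Ce] : exists2 C : R, 0 <= C & C%:C = `|e^-1|.
  exists (complex.Re `|e^-1|); last by rewrite RRe_real ?normr_real.
  by rewrite -lecR RRe_real ?normr_real ?normr_ge0.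
exists J; split.
- by move=> x; exact: (jP x).1.
- apply: (bounded_linear_continuous (f := J)).
  apply/linear_boundedP.
  apply: filterS (nbhs_pinfty_ge (normr_real e^-1)) => r er x.
  by apply: le_trans (jP x).2 _; rewrite ler_wpM2r.
- move=> x y Jxy; apply: (@disk_incl_inj _ _ _ d1).
  by rewrite -!(jP _).1; congr (disk_incl _ _).
by exists C => // x; rewrite Ce; exact: (jP x).2.
Qed.

End Disks.

(** * Families with common compact support over a metrizable space *)

Section Main.

Context {R : realType} (V : bornVectType R) {n : nat} (G : lieGroupType R n).

Lemma Cinfc_bounded_D_bounded (S : set (G -> V)) (K : set G) :
  metrizable V -> compact K -> (forall f, S f -> forall g, ~ K g -> f g = 0) ->
  Cinfc_bounded S -> D_bounded S.
Proof.
move=> mV cK SK SC.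
(* Each disk is paired with its Banach space, so that one application of choice selects both for all
   [k]. *)
have {}SC k : exists Td : {T : set V & banach_disk T},
    bdd (projT1 Td) /\ exists2 S' : set (G -> projT2 Td),
      Ckc_bounded k S' & S = [set disk_incl (projT2 Td) \o f | f in S'].
  have [T [d [S' [bT bS SS']]]] := SC k.
  by exists (existT _ T d); split=> //; exists S'.
have [Td TdP] := choice SC.
have [eps [eps0 bE]] :=
  metrizable_absorb (fun k => projT2 (Td k)) mV (fun k => (TdP k).1).
have [T ET [bT [d]]] := bdd_complete _ bE.
have emb k : [set eps k *: x | x in projT1 (Td k)] `<=` T.
  by move=> x Tx; apply: ET; exists k.
(* All lifts of members of [S] to [d]: a single set that serves every order [k]. *)
pose S0 : set (G -> d) := [set f : G -> d | S (disk_incl d \o f)].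
have lift k f : S f -> exists2 f' : G -> d,
    disk_incl d \o f' = f & Ck k f'.
  move=> Sf; have [_ [S' [S'C _] SS']] := TdP k.
  move: Sf; rewrite SS' => -[f1 /S'C[_ _ [Cf1 _]] <-].
  have [j [jE cj _ _]] :=
    disk_embedding (projT2 (Td k)) d (eps0 k) (emb k).
  exists (j \o f1); last exact: Ck_comp.
  by apply/funext => g /=; rewrite jE.
exists T, d, S0; split=> //; last first.
  apply/seteqP; split=> [f Sf|_ [f ? <-]//].
  by have [f' f'f _] := lift 0%N f Sf; exists f'; rewrite // /S0 /= f'f.
split.
- move=> f Sf k; have [f' f'f Cf'] := lift k _ Sf.
  (* The C^k lift found for each [k] is the same function, since [disk_incl d] is injective; hence
     [f] is smooth. *)
  suff -> : f = f' by [].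
  apply/funext => g; apply: (@disk_incl_inj _ _ _ d).
  by move/(congr1 (fun u => u g)): f'f.
- exists K => // f Sf g Kg; apply: (@disk_incl_inj _ _ _ d).
  by rewrite linear0; exact: (SK _ Sf g Kg).
move=> k D dD; have [_ [S' bS' SS']] := TdP k.
have [j [jE cj ij [C C0 jC]]] :=
    disk_embedding (projT2 (Td k)) d (eps0 k) (emb k).
(* With [k] the order of [D], the bound is obtained for functions valued in the [k]-th disk space
   and then pushed forward along [j]. *)
have [D' dD' DD'] := diff_op_pullback cj ij dD.
have [M bM] := unif_bounded_diff_op bS' dD'.
(* [C] bounds the norm of the inclusion [j], and [M] bounds [D'] on the lifts to the [k]-th disk
   space. *)
exists (C * M) => _ [f Sf <-] g.
move: Sf; rewrite /S0 /= SS' => -[f1 S'f1 f1f].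
have -> : f = j \o f1.
  apply/funext => x; apply: (@disk_incl_inj _ _ _ d) => /=; rewrite jE.
  by move/(congr1 (fun u => u x)): f1f.
have [_ _ [Cf1 _]] := bS'.1 _ S'f1.
rewrite DD' //; apply: le_trans (jC _) _.
rewrite rmorphM ler_wpM2l ?lecR //.
by apply: (bM (D' f1)); exists f1.
Qed.

End Main.

(** * Orbit maps of a differentiable representation *)

Theorem proposition3p18 (R : realType) (n : nat) (G : lieGroupType R n)
    (V : bornVectType R) (pi : G -> V -> V) :
  metrizable V -> representation pi -> differentiable_rep pi -> smooth_rep pi.
Proof.
move=> mV _ [piL _ piB].
have piD (A : set V) (h : G -> R[i]^o) : bdd A -> test_fun h ->
    D_bounded [set Defs.mul_fun h f | f in orbit_map pi @` A].
  move=> bA th; have [_ [K cK hK]] := th.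
  apply: (Cinfc_bounded_D_bounded mV cK); last exact: (piB A bA).2.
  by move=> _ [f _ <-] g Kg; rewrite /Defs.mul_fun hK // scale0r.
(* Membership for one orbit map follows from boundedness applied to the singleton of [v]. *)
have piE v : in_E (orbit_map pi v).
  move=> h th.
  have [T [d [S [bT [Ssm [K cK SK] _] SE]]]] := piD _ h (bdd_set1 v) th.
  have : [set Defs.mul_fun h f | f in orbit_map pi @` [set v]]
      (Defs.mul_fun h (orbit_map pi v)).
    by exists (orbit_map pi v) => //; exists v.
  rewrite SE => -[f Sf ff]; exists T, d, f; split=> //.
  by split; [exact: Ssm | exists K => //; exact: SK].
split=> // A bA; split=> [_ [v _ <-]//|h th]; exact: piD.
Qed.
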